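(* Let $\lambda\in\mathbf{C}$ with $\lambda\ne 1$. For all integers $r,s\ge 0$ and $n\ge 0$, $$H_n^{(r-s)}(x\vert\lambda)=\sum_{l=0}^{\min\{s,n\}}\left\{\binom{n}{l}\sum_{m=0}^{l}\frac{\binom{s}{m}}{(1-\lambda)^m}\sum_{\substack{k_1+\cdots+k_m=l\\ k_j\ge 1}}\binom{l}{k_1,\dots,k_m}\right\}H_{n-l}^{(r)}(x\vert\lambda)$$ $$\qquad+\sum_{l=\min\{s,n\}+1}^{n}\left\{\binom{n}{l}\sum_{m=0}^{\min\{s,n\}}\frac{\binom{s}{m}}{(1-\lambda)^m}\sum_{\substack{k_1+\cdots+k_m=l\\ k_j\ge 1}}\binom{l}{k_1,\dots,k_m}\right\}H_{n-l}^{(r)}(x\vert\lambda).$$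
   Context: For an integer $a$ (possibly negative), the Frobenius-Euler polynomials of order $a$, $H_n^{(a)}(x\vert\lambda)$, are defined by the formal power series identity $\left(\frac{1-\lambda}{e^t-\lambda}\right)^a e^{xt}=\sum_{n=0}^\infty H_n^{(a)}(x\vert\lambda)\frac{t^n}{n!}$; in particular $H_n^{(0)}(x\vert\lambda)=x^n$. The innermost sums run over $m$-tuples $(k_1,\dots,k_m)$ of positive integers with sum $l$, and $\binom{l}{k_1,\dots,k_m}=\frac{l!}{k_1!\cdots k_m!}$ is the multinomial coefficient. For $m=0$ the innermost sum equals $1$ if $l=0$ and $0$ if $l\ge 1$. A sum whose lower limit exceeds its upper limit is $0$. *)

(* Defs.v *)
From HB Require Import structures.
From mathcomp Require Import all_boot all_order all_algebra.
From mathcomp Require Import boolp.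

Set Implicit Arguments.
Unset Strict Implicit.
Unset Printing Implicit Defensive.

Import GRing.Theory Num.Theory.
Local Open Scope ring_scope.

(* The ring A[[t]] of formal power series. A record (rather than a synonym    *)
(* for nat -> A) keeps the Cauchy product apart from the pointwise one.       *)
Record fps (A : Type) : Type := Fps { fps_coef : nat -> A }.

Lemma fpsP (A : Type) (f g : fps A) : fps_coef f =1 fps_coef g -> f = g.
Proof. by case: f g => f [g] /= /funext ->. Qed.

HB.instance Definition _ (A : Type) := gen_eqMixin (fps A).
HB.instance Definition _ (A : Type) := gen_choiceMixin (fps A).

Section FpsRing.
Variable A : comNzRingType.
Implicit Types f g h : fps A.

Definition fpsC (a : A) : fps A := Fps (fun n => if n is 0 then a else 0).
Definition fps_add f g := Fps (fun n => fps_coef f n + fps_coef g n).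
Definition fps_opp f := Fps (fun n => - fps_coef f n).
Definition fps_mul f g :=
  Fps (fun n => \sum_(i < n.+1) fps_coef f i * fps_coef g (n - i)%N).

Lemma fps_addA : associative fps_add.
Proof. by move=> f g h; apply: fpsP => n /=; rewrite addrA. Qed.
Lemma fps_addC : commutative fps_add.
Proof. by move=> f g; apply: fpsP => n /=; rewrite addrC. Qed.
Lemma fps_add0 : left_id (fpsC 0) fps_add.
Proof. by move=> f; apply: fpsP => -[|n] /=; rewrite add0r. Qed.
Lemma fps_addN : left_inverse (fpsC 0) fps_opp fps_add.
Proof. by move=> f; apply: fpsP => -[|n] /=; rewrite addNr. Qed.

HB.instance Definition _ :=
  GRing.isZmodule.Build (fps A) fps_addA fps_addC fps_add0 fps_addN.

Definition fps_trunc N f : {poly A} := \poly_(i < N) fps_coef f i.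

Lemma coef_fps_trunc N f i : (i < N)%N -> (fps_trunc N f)`_i = fps_coef f i.
Proof. by move=> lt_iN; rewrite coef_poly lt_iN. Qed.

Lemma coef_fps_truncM N f g i : (i < N)%N ->
  (fps_trunc N f * fps_trunc N g)`_i = fps_coef (fps_mul f g) i.
Proof.
move=> lt_iN; rewrite coefM; apply: eq_bigr => j _.
have le_ji : (j <= i)%N by rewrite -ltnS.
rewrite !coef_fps_trunc ?(leq_ltn_trans _ lt_iN) //.
by rewrite leq_subr.
Qed.

Lemma fps_mulA : associative fps_mul.
Proof.
move=> f g h; apply: fpsP => n.
pose T k := fps_trunc n.+1 k.
transitivity (T f * (T g * T h))`_n.
  rewrite coefM; apply: eq_bigr => j _.
  by rewrite coef_fps_trunc ?coef_fps_truncM // ltnS leq_subr.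
rewrite mulrA coefM; apply: eq_bigr => j _.
by rewrite coef_fps_truncM // coef_fps_trunc // ltnS leq_subr.
Qed.

Lemma fps_mulC : commutative fps_mul.
Proof.
move=> f g; apply: fpsP => n.
by rewrite -!(@coef_fps_truncM n.+1) // mulrC.
Qed.

Lemma fps_mul1 : left_id (fpsC 1) fps_mul.
Proof.
move=> f; apply: fpsP => n /=.
by rewrite big_ord_recl /= subn0 mul1r big1 ?addr0 // => i _; rewrite mul0r.
Qed.

Lemma fps_mulDl : left_distributive fps_mul fps_add.
Proof.
move=> f g h; apply: fpsP => n /=.
by rewrite -big_split; apply: eq_bigr => i _; rewrite /= mulrDl.
Qed.

Lemma fps_oner_neq0 : fpsC 1 != 0 :> fps A.
Proof. by apply/eqP => /(congr1 (@fps_coef A ^~ 0%N))/eqP; rewrite oner_eq0. Qed.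

HB.instance Definition _ := GRing.Zmodule_isComNzRing.Build (fps A)
  fps_mulA fps_mulC fps_mul1 fps_mulDl fps_oner_neq0.

(* A series is a unit as soon as it has an inverse; see fps_unitE below.      *)
Definition fps_unit : pred (fps A) := fun f => `[< exists g, g * f = 1 >].
Definition fps_inv f : fps A :=
  if pselect (exists g, g * f = 1) is left fU then projT1 (cid fU) else f.

Lemma fps_mulVf : {in fps_unit, left_inverse 1 fps_inv *%R}.
Proof.
move=> f /asboolP fU; rewrite /fps_inv; case: pselect => // fU'.
by case: cid.
Qed.

Lemma fps_unitP f g : g * f = 1 -> fps_unit f.
Proof. by move=> gf1; apply/asboolP; exists g. Qed.

Lemma fps_inv_out : {in [predC fps_unit], fps_inv =1 id}.
Proof.
move=> f /asboolP fU; rewrite /fps_inv; by case: pselect.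
Qed.

HB.instance Definition _ := GRing.ComNzRing_hasMulInverse.Build (fps A)
  fps_mulVf fps_unitP fps_inv_out.

End FpsRing.

Lemma fps_unitE (A : comUnitRingType) (f : fps A) :
  (f \is a GRing.unit) = (fps_coef f 0 \is a GRing.unit).
Proof.
apply/idP/idP => [fU|f0U].
  apply/unitrPr; exists (fps_coef f^-1 0).
  have := congr1 (@fps_coef A ^~ 0%N) (divrr fU).
  by rewrite /= big_ord_recl big_ord0 addr0 subn0.
pose step (s : seq A) :=
  rcons s (((size s == 0)%N%:R - \sum_(i < size s) fps_coef f (size s - i) * s`_i)
           / fps_coef f 0).
pose s n := iter n step [::].
have sz n : size (s n) = n by elim: n => //= n IHn; rewrite size_rcons IHn.
have sE m n i : (i < m <= n)%N -> (s n)`_i = (s m)`_i.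
  case/andP=> lt_im; elim: n => [|n IHn]; first by rewrite leqn0 => /eqP ->.
  rewrite leq_eqVlt => /predU1P[-> //|]; rewrite ltnS => le_mn.
  by rewrite /= nth_rcons sz (leq_trans lt_im le_mn) IHn.
pose g := Fps (fun n => (s n.+1)`_n).
suff fg1 : f * g = 1 by apply/unitrPr; exists g.
apply: fpsP => n /=; rewrite big_ord_recl subn0 /=.
rewrite nth_rcons sz ltnn eqxx [X in X + _]mulrC divrK //.
have -> : \sum_(i < n) fps_coef f (bump 0 i) * (s (n - bump 0 i).+1)`_(n - bump 0 i)
   = \sum_(i < n) fps_coef f (n - i) * (s n)`_i.
  rewrite (reindex_inj rev_ord_inj) /=; apply: eq_bigr => i _.
  rewrite /bump leq0n add1n subnSK // !subKn 1?ltnW //.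
  by rewrite (@sE i.+1 n) // leqnn ltn_ord.
by rewrite subrK; case: n.
Qed.

(* e^(a t), as a formal power series in t.                                    *)
Definition fps_exp (A : comUnitRingType) (a : A) : fps A :=
  Fps (fun n => a ^+ n / n`!%:R).

(* H_n^(a)(x | lambda), a polynomial in x: n! times the coefficient of t^n in *)
(* ((1 - lambda) / (e^t - lambda))^a e^(x t), computed in K[x][[t]]. For      *)
(* lambda != 1 the series e^t - lambda is a unit (FE_denom_unit), so that the *)
(* division and the power with exponent a : int have their usual meaning.     *)
Definition frobenius_euler (K : numFieldType) (lambda : K) (a : int) (n : nat) :
    {poly K} :=
  n`!%:R * fps_coef
    ((fpsC (1 - lambda)%:P / (fps_exp 1 - fpsC lambda%:P)) ^ a * fps_exp 'X) n.

Lemma FE_denom_unit (K : numFieldType) (lambda : K) : lambda != 1 ->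
  (fps_exp 1 - fpsC lambda%:P : fps {poly K}) \is a GRing.unit.
Proof.
move=> lambda_neq1; rewrite fps_unitE /= expr0 divr1 -polyCB.
by apply: rmorph_unit; rewrite unitfE subr_eq0 eq_sym.
Qed.

Lemma fact_polyU (K : numFieldType) (n : nat) :
  (n`!%:R : {poly K}) \is a GRing.unit.
Proof.
rewrite -polyC_natr; apply: rmorph_unit.
by rewrite unitfE pnatr_eq0 -lt0n fact_gt0.
Qed.

Lemma frobenius_euler_egf (K : numFieldType) (lambda : K) (a : int) :
  (fpsC (1 - lambda)%:P / (fps_exp 1 - fpsC lambda%:P)) ^ a * fps_exp 'X =
  Fps (fun n => frobenius_euler lambda a n / n`!%:R).
Proof. by apply: fpsP => n /=; rewrite mulrAC divrr ?mul1r ?fact_polyU. Qed.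

Lemma frobenius_euler0 (K : numFieldType) (lambda : K) (n : nat) :
  frobenius_euler lambda 0 n = 'X^n.
Proof.
by rewrite /frobenius_euler expr0z mul1r /= mulrC divrK ?fact_polyU.
Qed.

(* The sum, over the m-tuples of positive integers k_1, ..., k_m with sum l,  *)
(* of the multinomial coefficients l! / (k_1! ... k_m!). Bounding the entries *)
(* by l loses no tuple.                                                       *)
Definition multinomial_sum (K : fieldType) (m l : nat) : K :=
  \sum_(k : {ffun 'I_m -> 'I_l.+1} |
          [forall j, (0 < k j)%N] && (\sum_j k j == l)%N)
     l`!%:R / \prod_j (k j)`!%:R.

(* Main.v *)
Require Import Defs.
From mathcomp Require Import all_boot all_order all_algebra.
From mathcomp Require Import reals complex.

Import GRing.Theory Num.Theory.
Local Open Scope ring_scope.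

(** Put U = (1 - lambda) / (e^t - lambda), so that the Frobenius-Euler
    polynomials of order a have exponential generating function U^a e^(x t).
    The inverse of U is 1 + (e^t - 1) / (1 - lambda), hence lowering the order
    by s multiplies the generating function by
    U^-s = sum_m binom(s, m) (1 - lambda)^-m (e^t - 1)^m.
    The coefficient of t^l / l! in (e^t - 1)^m is the sum of the multinomial
    coefficients over the compositions of l into m positive parts
    ([coef_expS1_exp]), because e^t - 1 is the sum of the t^k / k! over k > 0.
    Comparing the coefficients of t^n / n! expresses the polynomials of order
    a - s by those of order a, for every integer a
    ([frobenius_euler_lower_order]), with m running from 0 to s for each l.

    The two ranges of m in the theorem come from this single one by discarding
    zero terms. When l <= min(s, n), the terms with m > l vanish because l has
    no composition into more than l parts. The range l > min(s, n), l <= n is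
    nonempty only if s < n, and then min(s, n) = s. *)

Section FpsCoef.
Variable A : comNzRingType.
Implicit Types (a b : A) (f g : fps A).

Lemma fps_coefM f g n :
  fps_coef (f * g) n = \sum_(i < n.+1) fps_coef f i * fps_coef g (n - i)%N.
Proof. by []. Qed.

Lemma fps_coefCM a f n : fps_coef (fpsC a * f) n = a * fps_coef f n.
Proof.
rewrite fps_coefM big_ord_recl subn0 big1 ?addr0 // => i _.
by rewrite mul0r.
Qed.

Lemma fps_coef_sum (I : Type) (r : seq I) (F : I -> fps A) n :
  fps_coef (\sum_(i <- r) F i) n = \sum_(i <- r) fps_coef (F i) n.
Proof.
apply: (big_morph (fun f => fps_coef f n) (id1 := 0)) => //.
by case: n.
Qed.

Lemma fps_coefMn f k n : fps_coef (f *+ k) n = fps_coef f n *+ k.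
Proof.
by rewrite -[k]subn0 -!sumr_const_nat fps_coef_sum.
Qed.

Lemma fpsCM a b : fpsC (a * b) = fpsC a * fpsC b.
Proof. by apply: fpsP => -[|n]; rewrite fps_coefCM //= mulr0. Qed.

Lemma fpsCX a n : fpsC (a ^+ n) = fpsC a ^+ n.
Proof. by elim: n => [//|n IHn]; rewrite !exprS fpsCM IHn. Qed.

Lemma coef_fps_truncX N f m i : (i < N)%N ->
  (fps_trunc N f ^+ m)`_i = fps_coef (f ^+ m) i.
Proof.
elim: m i => [|m IHm] i lt_iN; first by rewrite !expr0 coef1; case: i lt_iN.
rewrite !exprS coefM fps_coefM; apply: eq_bigr => j _.
rewrite coef_fps_trunc ?IHm //; first by rewrite (leq_ltn_trans (leq_subr _ _)).
by rewrite (leq_ltn_trans _ lt_iN) // -ltnS.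
Qed.

(** Exponents above l cannot contribute to the coefficient of t^l, so f may be
    replaced by its truncation, a finite sum of monomials, and the power of
    that sum expanded by distributivity. *)
Lemma fps_coefX f m l :
  fps_coef (f ^+ m) l =
    \sum_(k : {ffun 'I_m -> 'I_l.+1} | (\sum_j k j == l)%N)
      \prod_j fps_coef f (k j).
Proof.
rewrite -(@coef_fps_truncX l.+1) // /fps_trunc poly_def.
rewrite -[in LHS](card_ord m) -prodr_const bigA_distr_bigA coef_sum.
rewrite [RHS]big_mkcond; apply: eq_bigr => k _ /=.
rewrite scaler_prod prodrXr coefZ coefXn eq_sym.
by case: (_ == l); rewrite ?mulr1 ?mulr0.
Qed.

End FpsCoef.

Section MultinomialSum.
Variable K : numFieldType.

Lemma coef_expS1 n :
  fps_coef (fps_exp 1 - 1 : fps {poly K}) n = ((0 < n)%N%:R / n`!%:R)%:P.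
Proof.
have -> : fps_coef (fps_exp 1 - 1 : fps {poly K}) n
        = 1 ^+ n / n`!%:R - (n == 0)%N%:R by case: n.
rewrite expr1n; case: n => [|n] /=; first by rewrite fact0 divr1 subrr mul0r.
rewrite subr0 !mul1r rmorphV ?rmorph_nat //.
by rewrite unitfE pnatr_eq0 -lt0n fact_gt0.
Qed.

(** In the expansion of the power over all tuples of exponents, a tuple with a
    zero entry contributes 0, since e^t - 1 has no constant term; the others
    contribute 1 / (k_1! ... k_m!). *)
Lemma coef_expS1_exp m l :
  l`!%:R * fps_coef ((fps_exp 1 - 1 : fps {poly K}) ^+ m) l =
    (multinomial_sum K m l)%:P.
Proof.
rewrite fps_coefX mulr_sumr rmorph_sum /=.
rewrite big_mkcond [RHS]big_mkcond; apply: eq_bigr => k _.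
rewrite andbC; case: (_ == l); rewrite //=.
rewrite (eq_bigr _ (fun j _ => coef_expS1 (k j))).
rewrite -rmorph_prod -polyC_natr -polyCM /= big_split /= prodfV.
case: ifP => [/forallP k_gt0|/negbT].
  by rewrite big1 ?mul1r // => j _; rewrite k_gt0.
rewrite negb_forall => /existsP[j kj0].
by rewrite (bigD1 j) //= (negbTE kj0) !mul0r mulr0.
Qed.

Lemma multinomial_sum_eq0 m l : (l < m)%N -> multinomial_sum K m l = 0.
Proof.
move=> lt_lm; apply: big_pred0 => k; apply/negbTE/negP.
case/andP=> /forallP k_gt0 /eqP sumk.
suff: (m <= l)%N by rewrite leqNgt lt_lm.
by rewrite -{1}[m]card_ord -sum1_card -sumk leq_sum.
Qed.

End MultinomialSum.

Section FrobeniusEuler.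
Variables (K : numFieldType) (lambda : K).
Hypothesis lambda_neq1 : lambda != 1.

Let U : fps {poly K} := fpsC (1 - lambda)%:P / (fps_exp 1 - fpsC lambda%:P).

(** The right factor is (e^t - lambda) / (1 - lambda), written as a polynomial
    in e^t - 1 so that the binomial theorem yields its powers in terms of
    those of e^t - 1. *)
Lemma FE_base_inv :
  U * (fpsC ((1 - lambda)^-1)%:P * (fps_exp 1 - 1) + 1) = 1.
Proof.
have lambda_unit : 1 - lambda != 0 by rewrite subr_eq0 eq_sym.
have cV : fpsC (1 - lambda)%:P * fpsC ((1 - lambda)^-1)%:P = 1.
  by rewrite -fpsCM -polyCM divff.
have -> : U * (fpsC ((1 - lambda)^-1)%:P * (fps_exp 1 - 1) + 1)
        = (fps_exp 1 - 1 + fpsC (1 - lambda)%:P) / (fps_exp 1 - fpsC lambda%:P).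
  by rewrite /U mulrAC mulrDr mulr1 mulrA cV mul1r.
have -> : fpsC (1 - lambda)%:P = 1 - fpsC lambda%:P :> fps {poly K}.
  by apply: fpsP => -[|i] /=; rewrite ?polyCB ?subr0.
by rewrite addrA subrK divrr ?FE_denom_unit.
Qed.

Lemma FE_base_unit : U \is a GRing.unit.
Proof. by apply/unitrPr; eexists; apply: FE_base_inv. Qed.

Lemma coef_FE_base_invX s l :
  l`!%:R * fps_coef (U^-1 ^+ s) l =
    (\sum_(0 <= m < s.+1)
       'C(s, m)%:R / (1 - lambda) ^+ m * multinomial_sum K m l)%:P.
Proof.
rewrite (mulr1_eq FE_base_inv) exprD1n big_mkord rmorph_sum fps_coef_sum.
rewrite mulr_sumr; apply: eq_bigr => m _ /=.
rewrite exprMn -fpsCX fps_coefMn fps_coefCM -mulrnAl mulrCA coef_expS1_exp.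
by rewrite -polyC_exp exprVn polyCM -polyCMn mulr_natl.
Qed.

(** This is the product U^a e^(x t) * U^-s read on exponential generating
    functions, where a Cauchy product becomes a binomial convolution. *)
Lemma frobenius_euler_lower_order (a : int) (s n : nat) :
  frobenius_euler lambda (a - s%:Z) n =
    \sum_(0 <= l < n.+1)
      ('C(n, l)%:R * \sum_(0 <= m < s.+1)
         'C(s, m)%:R / (1 - lambda) ^+ m * multinomial_sum K m l)
      *: frobenius_euler lambda a (n - l).
Proof.
rewrite /frobenius_euler -/U exprzDr ?FE_base_unit // -exprz_inv -exprnP.
rewrite -mulrA mulrCA fps_coefM mulr_sumr big_mkord; apply: eq_bigr => l _.
rewrite -mul_polyC polyCM -coef_FE_base_invX.
have le_ln : (l <= n)%N by rewrite -ltnS.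
rewrite -(bin_fact le_ln) !natrM polyC_natr.
by rewrite -!mulrA; congr (_ * (_ * _)); rewrite mulrCA.
Qed.

End FrobeniusEuler.

Theorem theorem2 (R : realType) (lambda : R[i]) (hlambda : lambda <> 1)
    (r s n : nat) :
  frobenius_euler lambda (r%:Z - s%:Z) n =
    \sum_(0 <= l < (minn s n).+1)
      ('C(n, l)%:R * \sum_(0 <= m < l.+1)
         'C(s, m)%:R / (1 - lambda) ^+ m * multinomial_sum R[i] m l)
      *: frobenius_euler lambda r%:Z (n - l)
  + \sum_((minn s n).+1 <= l < n.+1)
      ('C(n, l)%:R * \sum_(0 <= m < (minn s n).+1)
         'C(s, m)%:R / (1 - lambda) ^+ m * multinomial_sum R[i] m l)
      *: frobenius_euler lambda r%:Z (n - l).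
Proof.
rewrite frobenius_euler_lower_order; last exact/eqP.
rewrite (big_cat_nat (n := (minn s n).+1)) ?ltnS ?geq_minr //=.
congr (_ + _); apply: eq_big_nat => l /andP[lb ub]; congr (_ * _ *: _).
  have le_ls : (l <= s)%N by move: ub; rewrite ltnS leq_min => /andP[].
  rewrite (big_cat_nat (n := l.+1)) //= -[RHS]addr0; congr (_ + _).
  rewrite big_nat big1 // => m /andP[lt_lm _].
  by rewrite multinomial_sum_eq0 ?mulr0.
(* If n < s, then min(s, n) = n and no l lies in the second range. *)
suff /minn_idPl -> : (s <= n)%N by [].
rewrite leqNgt; apply/negP => /ltnW /minn_idPr min_n.
by move: (leq_ltn_trans lb ub); rewrite min_n ltnn.
Qed.
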